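(* Let $d\geq 2$, let $n\geq d+2$, and let $F_1,\ldots,F_n\subseteq\mathbb{R}^d$. Suppose that $\bigcap_{i\in I}F_i$ has exactly two nonempty closed convex components for every $I\subseteq\{1,\ldots,n\}$ with $|I|\in\{1,2,3,d+1\}$. Then $\bigcap_{i=1}^n F_i$ has exactly two nonempty closed convex components.
   Context: A subset $F\subseteq\mathbb{R}^d$ has ''exactly two nonempty closed convex components'' if it has exactly two connected components and both of them are nonempty closed convex sets. *)

(* Defs.v *)
From HB Require Import structures.
From mathcomp Require Import all_boot all_order all_algebra.
From mathcomp Require Import boolp classical_sets functions cardinality reals.
From mathcomp Require Import topology normedtype convex.

Set Implicit Arguments.
Unset Strict Implicit.
Unset Printing Implicit Defensive.

Import Order.TTheory GRing.Theory Num.Theory.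
Import numFieldNormedType.Exports.

Local Open Scope classical_set_scope.
Local Open Scope ring_scope.
Local Open Scope card_scope.

Definition components (T : topologicalType) (A : set T) : set (set T) :=
  connected_component A @` A.

(* R^d is 'rV[R]_d with the library's topology on matrices, generated by the
   sup-distance; it coincides with the Euclidean topology. *)
Definition two_closed_convex_components (R : realType) (d : nat)
    (A : set 'rV[R]_d) : Prop :=
  (components A #= `I_2) /\
  (forall C : set 'rV[R]_d, components A C ->
     [/\ C !=set0, closed C & convex_set C]).

(* Main.v *)
Require Import Defs.
From HB Require Import structures.
From mathcomp Require Import all_boot all_order all_algebra.
From mathcomp Require Import boolp classical_sets functions cardinality reals.
From mathcomp Require Import interval_inference topology normedtype convex.

Set Implicit Arguments.
Unset Strict Implicit.
Unset Printing Implicit Defensive.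

Import Order.TTheory GRing.Theory Num.Theory.
Import numFieldNormedType.Exports.

Local Open Scope classical_set_scope.
Local Open Scope ring_scope.

(** Label the two components of each [F i] by booleans. The components of the
    intersection of the [F i], [i] in [I], are the nonempty cells, one for each
    word [u : I -> bool] such that the components labelled [u i] have a common
    point. Say that [m] is below [i] if both components of [F m] meet [F i].
    Having two cells for pairs and for triples makes this a total preorder, and
    the letter of a nonempty word on [I] at an element [m] of [I] below all the
    others determines the whole word. So a set [I] with exactly two cells has
    exactly one for each letter at [m]. Take [m] below all indices: gluing the
    cells of the pairs [{i, m}] gives, for each letter at [m], one global word,
    which is nonempty on pairs by the triple condition, hence on every set of
    [d + 1] indices (apply the above to a minimal element of that set), hence
    globally by Helly's theorem. *)

(** * Words with exactly two nonempty cells *)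

Definition agree (J : finType) (I : {set J}) (u v : J -> bool) :=
  forall i, i \in I -> u i = v i.

(** Words are total functions, so they are counted up to agreement on [I]. The relation [ne]
    abstracts nonemptiness of cells; the equivalence makes [ne I] blind to letters outside [I]. *)
Definition exactly_two (J : finType) (ne : {set J} -> (J -> bool) -> Prop)
    (I : {set J}) :=
  exists u v, ~ agree I u v /\
    forall w, ne I w <-> agree I w u \/ agree I w v.

Definition both_values (J : finType) (ne : {set J} -> (J -> bool) -> Prop)
    (I : {set J}) (m : J) :=
  forall b, exists2 w, ne I w & w m = b.

Lemma exactly_two_ext (J : finType) (ne : {set J} -> (J -> bool) -> Prop) I w w' :
  exactly_two ne I -> agree I w w' -> ne I w -> ne I w'.
Proof.
move=> [u [v [_ H]]] ww' /H [] h; apply/H; [left|right] => i iI;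
  by rewrite -ww' // h.
Qed.

(** Over the empty set any two words agree. *)
Lemma exactly_two_nonempty (J : finType) (ne : {set J} -> (J -> bool) -> Prop) I :
  exactly_two ne I -> exists i, i \in I.
Proof.
move=> [u [v [uv _]]]; apply/existsP; apply: contra_notT uv.
by rewrite negb_exists => /forallP h i iI; move: (h i); rewrite iI.
Qed.

(** Since both letters occur at [m], the two classes of words differ there, so the letter at [m]
    tells which class a word is in. *)
Lemma both_values_agree (J : finType) (ne : {set J} -> (J -> bool) -> Prop)
    I m w w' :
  exactly_two ne I -> m \in I -> both_values ne I m ->
  ne I w -> ne I w' -> w m = w' m -> agree I w w'.
Proof.
move=> [u [v [_ H]]] mI B.
have uv : u m <> v m.
  move=> e; have [x /H hx xT] := B true; have [y /H hy yF] := B false.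
  by case: hx hy => /(_ m mI) + [] /(_ m mI); rewrite xT yF ?e; case: (v m).
move=> /H hw /H hw' e i iI.
by case: hw hw' => hw [] hw'; rewrite hw // hw' //;
  exfalso; apply: uv; rewrite -(hw _ mI) e -(hw' _ mI).
Qed.

(** * The preorder on indices and the gluing of words *)

Section Combinatorics.
Context (J : finType) (ne : {set J} -> (J -> bool) -> Prop).
Hypothesis mono : forall (A B : {set J}) u, A \subset B -> ne B u -> ne A u.

Lemma both_values_sub (A B : {set J}) m :
  A \subset B -> both_values ne B m -> both_values ne A m.
Proof. by move=> AB h b; have [w nw wm] := h b; exists w; [exact: mono nw|]. Qed.

(** Two inequivalent words must differ at [m], and two distinct booleans exhaust both values. *)
Lemma both_values_of_determined I m :
  exactly_two ne I ->
  (forall u v, ne I u -> ne I v -> u m = v m -> agree I u v) ->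
  both_values ne I m.
Proof.
move=> [u [v [uv H]]] det b.
have nu : ne I u by apply/H; left.
have nv : ne I v by apply/H; right.
have [ub|ub] := eqVneq (u m) b; first by exists u.
exists v => //; have [//|vb] := eqVneq (v m) b.
by case: uv; apply: det => //; move: ub vb; case: (u m) (v m) b => [] [] [].
Qed.

Hypothesis two_pairs : forall i j, exactly_two ne [set i; j]%SET.
Hypothesis two_triples : forall i j k, exactly_two ne [set i; j; k]%SET.

Local Notation below m i := (both_values ne [set i; m]%SET m).

(** Restrict both words to the pair of [i] and [m], where the letter at [m] decides. *)
Lemma below_det (I : {set J}) m i u v : m \in I -> i \in I -> below m i ->
  ne I u -> ne I v -> u m = v m -> u i = v i.
Proof.
move=> mI iI b nu nv e.
have s : [set i; m]%SET \subset I.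
  by apply/fintype.subsetP => x; rewrite !inE => /orP[]/eqP->.
by apply: (both_values_agree (two_pairs i m) _ b (mono s nu) (mono s nv) e);
  rewrite !inE eqxx ?orbT.
Qed.

(** The two words on the pair differ at [i] or at [j]; wherever they differ, both letters occur. *)
Lemma below_total i j : below i j \/ below j i.
Proof.
have [u [v [uv H]]] := two_pairs i j.
have nu : ne [set i; j]%SET u by apply/H; left.
have nv : ne [set i; j]%SET v by apply/H; right.
have B m : u m != v m -> both_values ne [set i; j]%SET m.
  move=> d b; have [ub|ub] := eqVneq (u m) b; first by exists u.
  by exists v => //; move: d ub; case: (u m) (v m) b => [] [] [].
have [ei|/B] := eqVneq (u i) (v i); last by left; rewrite finset.setUC.
have [ej|/B] := eqVneq (u j) (v j); last by right.
by case: uv => k; rewrite !inE => /orP[]/eqP->.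
Qed.

(** On the triple, the letter at [k] forces the one at [j], which forces the one at [i]. So both
    letters occur at [k] on the triple, hence on the pair. *)
Lemma below_trans i j k : below k j -> below j i -> below k i.
Proof.
move=> kj ji; apply: (@both_values_sub _ [set i; j; k]%SET).
  by apply/fintype.subsetP => x; rewrite !inE => /orP[]->; rewrite ?orbT.
apply: both_values_of_determined => // u v nu nv e.
have iI : i \in [set i; j; k]%SET by rewrite !inE eqxx.
have jI : j \in [set i; j; k]%SET by rewrite !inE eqxx orbT.
have kI : k \in [set i; j; k]%SET by rewrite !inE eqxx orbT.
have ej := below_det kI jI kj nu nv e.
have ei := below_det jI iI ji nu nv ej.
by move=> x; rewrite !inE => /orP[/orP[]|] /eqP->.
Qed.

Lemma below_min (s : seq J) i0 : i0 \in s ->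
  exists2 m, m \in s & forall i, i \in s -> below m i.
Proof.
elim: s i0 => // j s IH i0 _.
case: s IH => [|k s] IH.
  exists j; rewrite ?inE // => i; rewrite inE => /eqP->.
  (* Reflexivity is totality on the diagonal. *)
  by case: (below_total j j).
have [m ms H] := IH k (mem_head _ _).
have [mj|jm] := below_total m j.
  by exists m => [|i]; rewrite inE ?ms ?orbT // => /orP[/eqP->|/H].
exists j => [|i]; rewrite inE ?eqxx // => /orP[/eqP->|/H mi].
  by case: (below_total j j).
exact: below_trans jm mi.
Qed.

Lemma both_values_min (I : {set J}) m : exactly_two ne I -> m \in I ->
  (forall i, i \in I -> below m i) -> both_values ne I m.
Proof.
move=> tI mI H; apply: both_values_of_determined => // u v nu nv e i iI.
exact: (below_det mI iI (H i iI) nu nv e).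
Qed.

Lemma exactly_two_all k (i0 : J) :
  (forall I : {set J}, #|I| = k -> exactly_two ne I) ->
  (forall u, (forall I : {set J}, #|I| = k -> ne I u) -> ne [set: J]%SET u) ->
  exactly_two ne [set: J]%SET.
Proof.
move=> twok helly.
have [m _ min] := below_min (mem_enum J i0).
have {}min i : below m i by apply: min; rewrite mem_enum.
(* The glued word [f b] takes at [i] the letter forced on the pair of [i] and [m] by the letter [b]
   at [m]. *)
have /choice[f fP] : forall b : bool, exists g : J -> bool,
    forall i, exists w, [/\ ne [set i; m]%SET w, w m = b & w i = g i].
  move=> b.
  have /choice[g gP] : forall i, exists c,
      exists w, [/\ ne [set i; m]%SET w, w m = b & w i = c].
    by move=> i; have [w nw wm] := min i b; exists (w i), w.
  by exists g.
have det (I : {set J}) b w : ne I w -> m \in I -> w m = b -> agree I w (f b).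
  move=> nw mI wm i iI; have [x [nx xm <-]] := fP b i.
  have s : [set i; m]%SET \subset I.
    by apply/fintype.subsetP => y; rewrite !inE => /orP[]/eqP->.
  have iM : i \in [set i; m]%SET by rewrite !inE eqxx.
  have mM : m \in [set i; m]%SET by rewrite !inE eqxx orbT.
  by apply: (below_det mM iM (min i) (mono s nw) nx); rewrite wm.
have fm b : f b m = b by have [x [_ <- <-]] := fP b m.
(* On the triple with [m], some nonempty word has letter [b] at [m]; by [det] it agrees with
   [f b]. *)
have pair b i j : ne [set i; j]%SET (f b).
  have mI : m \in [set i; j; m]%SET by rewrite !inE eqxx orbT.
  have [w nw wm] := both_values_min (two_triples i j m) mI (fun i _ => min i) b.
  have a := det _ _ _ nw mI wm.
  have s : [set i; j]%SET \subset [set i; j; m]%SET by exact: finset.subsetUl.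
  apply: exactly_two_ext (mono s nw) => // x xI.
  by apply: a; apply: (fintype.subsetP s).
(* With [p] minimal in [I], take a nonempty word on [I] having the letter of [f b] at [p].
   Comparison on each pair with [p], where [f b] is nonempty, shows that it agrees with [f b]. *)
have all b : ne [set: J]%SET (f b).
  apply: helly => I /twok tI.
  have [j0 j0I] := exactly_two_nonempty tI.
  have [] := @below_min (enum I) j0; first by rewrite mem_enum.
  move=> p; rewrite mem_enum => pI pmin.
  have {}pmin i : i \in I -> below p i by rewrite -mem_enum; apply: pmin.
  have [w nw wp] := both_values_min tI pI pmin (f b p).
  apply: (exactly_two_ext tI _ nw) => i iI.
  have iM : i \in [set i; p]%SET by rewrite !inE eqxx.
  have pM : p \in [set i; p]%SET by rewrite !inE eqxx orbT.
  have s : [set i; p]%SET \subset I.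
    by apply/fintype.subsetP => y; rewrite !inE => /orP[]/eqP->.
  exact: (below_det pM iM (pmin i iI) (mono s nw) (pair b i p)).
exists (f true), (f false); split.
  by move=> /(_ m (finset.in_setT m)); rewrite !fm.
have ext b w : agree [set: J]%SET w (f b) -> ne [set: J]%SET w.
  by move=> a; have -> : w = f b by apply/funext => i; apply: a; rewrite inE.
move=> w; split=> [nw|[] /ext //].
case e : (w m); [left|right]; by apply: det; rewrite ?inE.
Qed.
End Combinatorics.

(** * Radon's argument and Helly's theorem *)

Lemma convex_setP (R : numDomainType) (V : lmodType R) (A : set V) :
  convex_set A <-> forall (x y : V) t, 0 <= t -> t <= 1 -> A x -> A y ->
    A (t *: x + (1 - t) *: y).
Proof.
split=> [cA x y t t0 t1 /mem_set Ax /mem_set Ay|cA x y t /set_mem Ax /set_mem Ay].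
  by apply/set_mem; exact: (cA x y (Itv01 t0 t1) Ax Ay).
by apply/mem_set; apply: cA.
Qed.

Lemma convex_bigcap (R : numDomainType) (V : lmodType R) I (P : set I)
    (A : I -> set V) :
  (forall i, P i -> convex_set (A i)) -> convex_set (\bigcap_(i in P) A i).
Proof.
move=> cA; apply/convex_setP => x y t t0 t1 Ax Ay i Pi.
by move/convex_setP: (cA i Pi); apply => //; [exact: Ax|exact: Ay].
Qed.

Lemma convex_set_sum (R : numFieldType) (V : lmodType R) (A : set V)
    (I : finType) (P : pred I) (w : I -> R) (p : I -> V) :
  convex_set A -> (forall i, P i -> 0 <= w i) -> (forall i, P i -> A (p i)) ->
  0 < \sum_(i | P i) w i ->
  A ((\sum_(i | P i) w i)^-1 *: \sum_(i | P i) w i *: p i).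
Proof.
move=> /convex_setP cA w0 Ap.
(* This invariant of a total weight and a weighted sum is additive; its first case covers empty sums
   and zero weights. *)
pose Q (a : R) (v : V) := (a = 0 /\ v = 0) \/ (0 < a /\ A (a^-1 *: v)).
suff [[-> _]|[]//] : Q (\sum_(i | P i) w i) (\sum_(i | P i) w i *: p i).
  by rewrite ltxx.
apply: (big_ind2 Q); first by left.
- move=> a v b u [[-> ->]|[a0 Av]]; first by rewrite !add0r.
  move=> [[-> ->]|[b0 Bu]]; first by rewrite !addr0; right.
  have ab0 : 0 < a + b by rewrite addr_gt0.
  right; split => //.
  have -> : (a + b)^-1 *: (v + u) =
      (a / (a + b)) *: (a^-1 *: v) + (1 - a / (a + b)) *: (b^-1 *: u).
    rewrite -[X in X - _](divff (lt0r_neq0 ab0)) -mulrBl addrAC subrr add0r.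
    rewrite !scalerA scalerDr; congr (_ *: _ + _ *: _).
      by rewrite mulrAC divff ?mul1r ?lt0r_neq0.
    by rewrite mulrAC divff ?mul1r ?lt0r_neq0.
  apply: cA => //; first by rewrite divr_ge0 ?ltW.
  by rewrite ler_pdivrMr// mul1r lerDl ltW.
- move=> i Pi; move: (w0 i Pi); rewrite le_eqVlt => /orP[/eqP<-|wi].
    by left; rewrite scale0r.
  by right; rewrite scalerA mulVf ?scale1r ?lt0r_neq0//; split => //; exact: Ap.
Qed.

Lemma affine_dependence (R : fieldType) d (J : finType) (I : {set J})
    (p : J -> 'rV[R]_d) : (d.+1 < #|I|)%N ->
  exists c : J -> R, [/\ \sum_(i in I) c i = 0, \sum_(i in I) c i *: p i = 0 &
    exists2 i, i \in I & c i != 0].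
Proof.
move=> dI.
(* A coordinate 1 is appended to each point. There are more rows than columns, so a nonzero row
   vector kills the matrix; the last column gives the zero sum of coefficients. *)
pose A : 'M[R]_(#|I|, d + 1) :=
  row_mx (\matrix_i p (enum_val i)) (const_mx 1).
have : kermx A != 0.
  rewrite -mxrank_eq0 mxrank_ker -lt0n subn_gt0.
  by apply: leq_ltn_trans (rank_leq_col _) _; rewrite addn1.
move=> /rowV0Pn[u /sub_kermxP uA u0].
have [i0 i0I] : exists i, i \in I.
  by apply/set0Pn; rewrite -card_gt0; apply: leq_trans dI.
pose c i := u 0 (enum_rank_in i0I i).
have sumI (V : zmodType) (G : J -> V) :
    \sum_(i in I) G i = \sum_(k < #|I|) G (enum_val k).
  by rewrite (@big_enum_val _ _ _ _ (mem I)).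
have cE (k : 'I_#|I|) : c (enum_val k) = u 0 k by rewrite /c enum_valK_in.
move: uA; rewrite mul_mx_row -[0 in RHS]row_mx0 => /eq_row_mx[u1 u2].
exists c; split.
- rewrite sumI; move/matrixP: u2 => /(_ 0 0); rewrite !mxE => e.
  by rewrite -[RHS]e; apply: eq_bigr => k _; rewrite mxE mulr1 cE.
- rewrite sumI -[RHS]u1 mulmx_sum_row; apply: eq_bigr => k _.
  by rewrite cE rowK.
- have [k uk] : exists k, u 0 k != 0.
    apply/existsP; apply: contraNT u0 => /existsPn h.
    by apply/eqP/rowP => k; rewrite mxE; apply/eqP; move: (h k); rewrite negbK.
  by exists (enum_val k); rewrite ?enum_valP// cE.
Qed.

(** Induction on the size of [I]: choose [p i] in all sets of [I] except perhaps the one of index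
    [i]. An affine dependence splits [I] by sign, and the Radon point common to the two hulls lies
    in every set. *)
Theorem helly (R : realFieldType) d (J : finType) (K : J -> set 'rV[R]_d) :
  (forall i, convex_set (K i)) -> (d.+1 <= #|J|)%N ->
  (forall I : {set J}, #|I| = d.+1 -> \bigcap_(i in [set` I]) K i !=set0) ->
  \bigcap_(i in [set: J]) K i !=set0.
Proof.
move=> cK dJ H.
suff all m (I : {set J}) : #|I| = (d.+1 + m)%N ->
    \bigcap_(i in [set` I]) K i !=set0.
  have [] := all (#|J| - d.+1)%N [set: J]%SET; first by rewrite cardsT subnKC.
  by move=> x Kx; exists x => i _; apply: Kx; rewrite /= finset.in_setT.
elim: m I => [|m IH] I cI; first by apply: H; rewrite cI addn0.
have /choice[p Ip] : forall i, exists x : 'rV[R]_d,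
    i \in I -> (\bigcap_(j in [set` I :\ i]) K j) x.
  move=> i; have [iI|_] := boolP (i \in I); last by exists 0.
  have [|x Kx] := IH (I :\ i); last by exists x.
  by move: cI; rewrite (cardsD1 i) iI add1n addnS => -[].
have {}Ip i j : i \in I -> j \in I -> i != j -> K j (p i).
  by move=> iI jI ij; apply: Ip => //=; rewrite !inE eq_sym ij.
have [|c [c0 cp [i0 i0I ci0]]] := @affine_dependence R d J I p.
  by rewrite cI addnS ltnS leq_addr.
pose P := fun i => (i \in I) && (0 < c i).
pose N := fun i => (i \in I) && ~~ (0 < c i).
pose s := \sum_(i | P i) c i.
have sN : s = \sum_(i | N i) - c i.
  by move/eqP: c0; rewrite (bigID (fun i => 0 < c i)) /= addr_eq0 sumrN => /eqP.
have vN : \sum_(i | P i) c i *: p i = \sum_(i | N i) - c i *: p i.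
  move/eqP: cp; rewrite (bigID (fun i => 0 < c i)) /= addr_eq0 => /eqP->.
  by rewrite -sumrN; apply: eq_bigr => i _; rewrite scaleNr.
(* If [s] were zero, all coefficients on [I] would vanish, against [ci0]. *)
have s0 : 0 < s.
  have sge0 : 0 <= s by apply: sumr_ge0 => i /andP[_ /ltW].
  rewrite lt_neqAle eq_sym sge0 andbT; apply/negP => /eqP s0.
  have cP i : P i -> c i = 0.
    by move: i; apply: psumr_eq0P => // i /andP[_ /ltW].
  have cN i : N i -> - c i = 0.
    move: i; apply: psumr_eq0P => [i /andP[_]|]; last by rewrite -sN.
    by rewrite -leNgt oppr_ge0.
  have [ci|ci] := boolP (0 < c i0).
    by move: ci0; rewrite cP ?eqxx// /P i0I.
  by move: ci0; rewrite -oppr_eq0 cN ?eqxx// /N i0I.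
exists (s^-1 *: \sum_(i | P i) c i *: p i) => j /= jI.
(* The Radon point is written over the sign class that does not contain [j], so that every [p i]
   used lies in [K j]. *)
have [cj|cj] := boolP (0 < c j).
  rewrite vN sN; apply: convex_set_sum => //; last by rewrite -sN.
    by move=> i /andP[_]; rewrite -leNgt oppr_ge0.
  move=> i /andP[iI ci]; apply: Ip => //.
  by apply: contraNneq ci => ->.
apply: convex_set_sum => //; first by move=> i /andP[_ /ltW].
move=> i /andP[iI ci]; apply: Ip => //.
by apply: contraNneq cj => <-.
Qed.

(** * Components of intersections *)

(** The set is the union of the segments from one of its points [x]. *)
Lemma convex_connected (R : realType) (V : normedModType R) (A : set V) :
  convex_set A -> connected A.
Proof.
move=> /convex_setP cA.
have [->|/set0P[x Ax]] := eqVneq A set0; first exact: connected0.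
pose seg (y : V) := (fun t : R => t *: y + (1 - t) *: x) @` `[0, 1]%classic.
have segP y t : 0 <= t -> t <= 1 -> seg y (t *: y + (1 - t) *: x).
  by move=> t0 t1; exists t => //=; rewrite in_itv /= t0 t1.
have -> : A = \bigcup_(y in A) seg y.
  apply/seteqP; split=> [y Ay|_ [y Ay [t + <-]]].
    exists y => //; have := segP y 1 ler01 (lexx _).
    by rewrite scale1r subrr scale0r addr0.
  by rewrite /= in_itv /= => /andP[t0 t1]; exact: cA.
apply: bigcup_connected => [|y Ay].
  exists x => y _; have := segP y 0 (lexx _) ler01.
  by rewrite scale0r add0r subr0 scale1r.
apply: connected_continuous_connected; first exact: segment_connected.
apply: continuous_subspaceT => t.
apply: cvgD; apply: cvgZr_tmp; first exact: cvg_id.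
by apply: cvgB; [exact: cvg_cst|exact: cvg_id].
Qed.

Lemma card_eq_II2 (T : pointedType) (A : set T) :
  (A #= `I_2)%card <-> exists x y, x <> y /\ A = [set x; y].
Proof.
split.
  rewrite card_eq_sym => /card_set_bijP[f [fA finj fsurj]].
  exists (f 0%N), (f 1%N); split.
    by move=> /finj; rewrite !inE => /(_ erefl erefl).
  apply/seteqP; split=> [z /fsurj[[|[|//]] _ <-]|z [] ->].
  - by left.
  - by right.
  - exact: fA.
  - exact: fA.
move=> [x [y [xy ->]]]; rewrite card_eq_sym; apply/card_set_bijP.
exists (fun n => if n is 0%N then x else y); split.
- by move=> [|n] _; [left|right].
- by move=> [|[|m]] [|[|n]]; rewrite !inE //= => _ _ /esym.
- by move=> z [] ->; [exists 0%N|exists 1%N].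
Qed.

(** The intersection of the components is convex, hence connected, and contains [x]; the other
    inclusion is maximality of each component. *)
Lemma connected_component_bigcap (R : realType) (V : normedModType R)
    (I : Type) (P : set I) (F : I -> set V) x :
  (forall i, P i -> convex_set (connected_component (F i) x)) ->
  (\bigcap_(i in P) F i) x ->
  connected_component (\bigcap_(i in P) F i) x =
    \bigcap_(i in P) connected_component (F i) x.
Proof.
move=> cF Fx; apply/seteqP; split.
  move=> y xy i Pi; apply: connected_component_max y xy.
  - exact: connected_component_refl.
  - by move=> z /connected_component_sub; apply.
  - exact: component_connected.
apply: connected_component_max.
- by move=> i Pi; apply: connected_component_refl; exact: Fx.
- by move=> y xy i Pi; apply: connected_component_sub (xy i Pi).
- by apply: convex_connected; exact: convex_bigcap.
Qed.

(** Provides the boolean labels. Disjointness holds because a point determines its component. *)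
Lemma two_closed_convex_components_pair (R : realType) d (A : set 'rV[R]_d) :
  two_closed_convex_components A -> exists K : bool -> set 'rV[R]_d,
    [/\ forall b, closed (K b) /\ convex_set (K b),
        components A = range K,
        (forall b c x, K b x -> K c x -> b = c) &
        forall b x, K b x -> connected_component A x = K b].
Proof.
move=> [/card_eq_II2[X [Y [XY AE]]] cA].
pose K (b : bool) := if b then X else Y.
have KA b : components A (K b) by rewrite AE; case: b; [left|right].
have comp b x : K b x -> connected_component A x = K b.
  have [y Ay <-] := KA b => yx; exact/esym/same_connected_component.
exists K; split.
- by move=> b; have [] := cA _ (KA b).
- rewrite AE; apply/seteqP; split=> [Z []->|_ [b _ <-]].
  + by exists true.
  + by exists false.
  + by case: b; [left|right].
- by move=> b c x /comp + /comp; move=> ->; case: b c => [] [] // /esym.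
- exact: comp.
Qed.

(** * Cells as the components of an intersection *)

Section Words.
Context (R : realType) (d : nat) (J : finType) (F : J -> set 'rV[R]_d).
Context (K : J -> bool -> set 'rV[R]_d).
Hypothesis K_closed : forall i b, closed (K i b).
Hypothesis K_convex : forall i b, convex_set (K i b).
Hypothesis K_components : forall i, components (F i) = range (K i).
Hypothesis K_disjoint : forall i b c x, K i b x -> K i c x -> b = c.
Hypothesis K_component : forall i b x, K i b x ->
  connected_component (F i) x = K i b.

Definition cell (I : {set J}) (u : J -> bool) :=
  \bigcap_(i in [set` I]) K i (u i).

Definition cell_nonempty (I : {set J}) (u : J -> bool) := cell I u !=set0.

Lemma cell_agree (I : {set J}) u v : agree I u v -> cell I u = cell I v.
Proof. by move=> a; apply: eq_bigcapr => i /= iI; rewrite a. Qed.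

Lemma agree_cell (I : {set J}) u v x : cell I u x -> cell I v x -> agree I u v.
Proof. by move=> ux vx i iI; apply: K_disjoint (ux i iI) (vx i iI). Qed.

Lemma cell_component (I : {set J}) u x : cell I u x ->
  connected_component (\bigcap_(i in [set` I]) F i) x = cell I u.
Proof.
move=> ux.
have e i : [set` I] i -> connected_component (F i) x = K i (u i).
  by move=> iI; apply: K_component; exact: ux.
rewrite connected_component_bigcap; first exact: eq_bigcapr.
- by move=> i /e ->.
- move=> i iI; apply: (@connected_component_sub _ _ x).
  by rewrite e //; exact: ux.
Qed.

Lemma components_bigcap (I : {set J}) :
  components (\bigcap_(i in [set` I]) F i) = cell I @` cell_nonempty I.
Proof.
apply/seteqP; split=> [_ [x Fx <-]|_ [u [x ux] <-]].
  (* The word of [x] records which component contains [x]; outside [I] its letter is arbitrary. *)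
  have /choice[u ux] : forall i, exists b, i \in I -> K i b x.
    move=> i; have [iI|_] := boolP (i \in I); last by exists true.
    have : components (F i) (connected_component (F i) x).
      by exists x => //; exact: Fx.
    rewrite K_components => -[b _ Kb]; exists b => _.
    by rewrite Kb; apply: connected_component_refl; exact: Fx.
  have cx : cell I u x by move=> i; exact: ux.
  by exists u; [exists x|rewrite (cell_component cx)].
exists x; last exact: cell_component.
move=> i iI; apply: (@connected_component_sub _ _ x).
by rewrite (K_component (ux i iI)); exact: ux.
Qed.

Lemma cell_inj (I : {set J}) u v :
  cell_nonempty I u -> cell I u = cell I v -> agree I u v.
Proof. by move=> [x ux] e; apply: (agree_cell ux); rewrite -e. Qed.

(** Nonempty cells coincide exactly when their words agree on [I], so counting components is
    counting words. Closedness and convexity pass to intersections. *)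
Lemma two_closed_convex_componentsP (I : {set J}) :
  two_closed_convex_components (\bigcap_(i in [set` I]) F i) <->
  exactly_two cell_nonempty I.
Proof.
rewrite /two_closed_convex_components components_bigcap; split.
  move=> [/card_eq_II2[X [Y [XY E]]] _].
  have [u nu uX] : (cell I @` cell_nonempty I) X by rewrite E; left.
  have [v nv vY] : (cell I @` cell_nonempty I) Y by rewrite E; right.
  exists u, v; split.
    by move=> /cell_agree; rewrite uX vY.
  move=> w; split.
    move=> nw; have : (cell I @` cell_nonempty I) (cell I w) by exists w.
    by rewrite E -uX -vY => -[] /(cell_inj nw); [left|right].
  by rewrite /cell_nonempty => -[] /cell_agree ->.
move=> [u [v [uv H]]].
have nu : cell_nonempty I u by apply/H; left.
have nv : cell_nonempty I v by apply/H; right.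
split; last first.
  move=> _ [w nw <-]; split => //.
  - by apply: closed_bigI => i _; exact: K_closed.
  - by apply: convex_bigcap => i _; exact: K_convex.
apply/card_eq_II2; exists (cell I u), (cell I v); split.
  by move=> /(cell_inj nu).
apply/seteqP; split=> [_ [w /H[] /cell_agree-> <-]|_ [] ->].
- by left.
- by right.
- by exists u.
- by exists v.
Qed.

End Words.

(** * Passage from sets to words and application of Helly's theorem *)

Theorem mainTheorem1 (R : realType) (d n : nat) (hd : (2 <= d)%N)
    (hn : (d + 2 <= n)%N) (F : 'I_n -> set 'rV[R]_d)
    (hF : forall I : {set 'I_n}, #|I| \in [:: 1; 2; 3; d + 1]%N ->
       two_closed_convex_components (\bigcap_(i in [set` I]) F i)) :
  two_closed_convex_components (\bigcap_(i in [set: 'I_n]) F i).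
Proof.
have dn : (d.+1 <= n)%N by apply: leq_trans hn; rewrite addn2.
have /choice[K HK] : forall i, exists K : bool -> set 'rV[R]_d,
    [/\ forall b, closed (K b) /\ convex_set (K b),
        components (F i) = range K,
        (forall b c x, K b x -> K c x -> b = c) &
        forall b x, K b x -> connected_component (F i) x = K b].
  (* Singletons in the hypothesis give the components of each [F i]. *)
  move=> i; apply: two_closed_convex_components_pair.
  have := hF [set i]%SET; rewrite cards1 => /(_ isT).
  congr two_closed_convex_components; apply/seteqP; split=> x h.
    by apply: h; rewrite /= finset.in_set1.
  by move=> j /=; rewrite finset.in_set1 => /eqP->.
have Kcl i b : closed (K i b) by have [/(_ b)[]] := HK i.
have Kcv i b : convex_set (K i b) by have [/(_ b)[]] := HK i.
have Kcomp i : components (F i) = range (K i) by have [] := HK i.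
have Kdis i b c x : K i b x -> K i c x -> b = c by have [_ _ + _] := HK i; apply.
have Kcc i b x : K i b x -> connected_component (F i) x = K i b.
  by have [_ _ _] := HK i; apply.
have twoP := two_closed_convex_componentsP Kcl Kcv Kcomp Kdis Kcc.
have -> : [set: 'I_n] = [set` [set: 'I_n]%SET].
  by apply/seteqP; split => // i _; rewrite /= finset.in_setT.
apply/twoP; apply: (@exactly_two_all _ _ _ _ _ d.+1).
- move=> A B u AB [x ux]; exists x => i /= iA; apply: ux => /=.
  exact: (fintype.subsetP AB).
(* Indices may repeat, so pairs have 1 or 2 elements and, below, triples have 1, 2 or 3. *)
- move=> i j; apply/twoP/hF; rewrite cards2.
  by case: (i != j).
- move=> i j k; apply/twoP/hF; rewrite finset.setUC cardsU1 cards2.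
  by case: (_ \notin _); case: (i != j).
- exact: (Ordinal (leq_trans (ltn0Sn d) dn)).
- by move=> I cI; apply/twoP/hF; rewrite cI addn1 !inE eqxx !orbT.
- move=> u hu.
  have [] := @helly R d 'I_n (fun i => K i (u i)).
  + by move=> i; exact: Kcv.
  + by rewrite card_ord.
  + by move=> I cI; exact: hu.
  + by move=> x hx; exists x => i _; exact: hx.
Qed.
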